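(* Let $n\in\mathbb{N}$, let $\mathcal{A}$ be a complex Banach algebra with identity, and let $a,b,c,d\in\mathcal{A}$ satisfy $acd=dbd$ and $dba=aca$. Then $1-ac$ has a generalized $n$-strongly Drazin inverse if and only if $1-bd$ has a generalized $n$-strongly Drazin inverse.
   Context: $n$ is a fixed natural number, $\mathbb{N}=\{1,2,3,\dots\}$. $U(\mathcal{A})$ is the set of units of $\mathcal{A}$. For $a\in \mathcal{A}$, $\mathrm{comm}(a)=\{x\in \mathcal{A} : xa=ax\}$ and $\mathrm{comm}^2(a)=\{x\in \mathcal{A} : xy=yx \text{ for all } y\in \mathrm{comm}(a)\}$. Set $\mathcal{A}^{qnil}=\{a\in \mathcal{A} : 1+ax\in U(\mathcal{A})\text{ for every }x\in \mathrm{comm}(a)\}$; in a Banach algebra, $a\in\mathcal{A}^{qnil}$ if and only if $\lim_{k\to\infty}\|a^k\|^{1/k}=0$. An element $a\in \mathcal{A}$ has a generalized $n$-strongly Drazin inverse if there exists $x\in \mathcal{A}$ such that $xax=x$, $x\in \mathrm{comm}^2(a)$ and $a^n-ax\in \mathcal{A}^{qnil}$. *)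

(* Defs.v *)
From HB Require Import structures.
From mathcomp Require Import all_boot all_order all_algebra.
From mathcomp Require Import all_classical all_reals all_analysis.
From mathcomp Require Export complex.

Set Implicit Arguments.
Unset Strict Implicit.
Unset Printing Implicit Defensive.

Import GRing.Theory Num.Theory.
Import numFieldNormedType.Exports.

Local Open Scope classical_set_scope.
Local Open Scope ring_scope.

(* A ring structure and a norm cannot be joined as parents of a new structure:
   Hierarchy-Builder demands that such a join precede [Num.NumDomain]. The
   product is therefore a mixin over Banach spaces, and the library's ring
   structure is derived from it below. The norm of the identity is not
   required to be 1, and the zero algebra is allowed. *)
HB.mixin Record CompleteNormedModule_isBanachAlgebra (K : numFieldType) A
    & CompleteNormedModule K A := {
  banach_one : A;
  banach_mul : A -> A -> A;
  banach_mulA : associative banach_mul;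
  banach_mul1l : left_id banach_one banach_mul;
  banach_mul1r : right_id banach_one banach_mul;
  banach_mulDl : left_distributive banach_mul +%R;
  banach_mulDr : right_distributive banach_mul +%R;
  banach_scaleAl : forall (k : K) (x y : A),
    k *: banach_mul x y = banach_mul (k *: x) y;
  banach_scaleAr : forall (k : K) (x y : A),
    k *: banach_mul x y = banach_mul x (k *: y);
  banach_normM : forall x y : A, `|banach_mul x y| <= `|x| * `|y|
}.

#[short(type="banachAlgType")]
HB.structure Definition BanachAlgebra (K : numFieldType) :=
  {A of CompleteNormedModule K A & CompleteNormedModule_isBanachAlgebra K A}.

HB.instance Definition _ (K : numFieldType) (A : banachAlgType K) :=
  GRing.Zmodule_isPzRing.Build (BanachAlgebra.sort A)
    (@banach_mulA K A) (@banach_mul1l K A) (@banach_mul1r K A)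
    (@banach_mulDl K A) (@banach_mulDr K A).

Section GeneralizedStronglyDrazin.
Context {A : pzRingType}.
Implicit Types a x y : A.

(* [GRing.unit] is only available for rings with [1 != 0]. *)
Definition is_unit a : Prop := exists y, a * y = 1 /\ y * a = 1.

Definition comm a : set A := [set x | x * a = a * x].

Definition comm2 a : set A := [set x | forall y, comm a y -> x * y = y * x].

Definition qnil : set A := [set a | forall x, comm a x -> is_unit (1 + a * x)].

Definition has_gnsDrazin (n : nat) a : Prop :=
  exists x, [/\ x * a * x = x, comm2 a x & qnil (a ^+ n - a * x)].

End GeneralizedStronglyDrazin.

(* Main.v *)
Require Import Defs.
From mathcomp Require Import all_boot all_order all_algebra.
From mathcomp Require Import all_classical all_reals all_analysis.

Import GRing.Theory.

Local Open Scope ring_scope.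
Local Open Scope complex_scope.

(** The argument is purely ring-theoretic and rests on two ideas.

    First, having a generalized n-strongly Drazin inverse is a statement about
    an idempotent: [a] has one iff some idempotent [p] in the double commutant
    of [a] makes [p - (1 - a ^+ n)] quasinilpotent
    ([gnsDrazin_idempotentP]); [1 - p] is then the product of [a] and its
    inverse [x]. For [a = 1 - m] the element [1 - (1 - m) ^+ n] is a multiple
    of [m], so [p] is, up to a quasinilpotent, a multiple of [m], and hence [m]
    is invertible on the range of [p] ([idempotent_partial_inverse]).

    Second, if [d * b * d = m * d] and [d * b * m = m * m], then [m * g]
    corresponds to [b * g * d] whenever [g] is the sum of a polynomial in [m]
    and a product [m * v] with [v] in the double commutant of [m]: in a product
    of two elements [b * g * d], the inner [d * b] can be replaced by [m]. The
    correspondence preserves idempotents of the second kind ([g = m * v]),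
    membership in the double commutant ([comm2_transport]) and
    quasinilpotence ([qnil_transport]), and it maps [1 - (1 - m) ^+ n] to
    [1 - (1 - b * d) ^+ n]. So it carries a witness [p] for [1 - m] to a witness
    for [1 - b * d] ([gnsDrazin_1B_transport]).

    With [m = a * c] this gives one implication. It also contains the swap of
    [1 - x * y] and [1 - y * x], and, since the two hypotheses say as well that
    [a * (c * a) = (d * b) * a] and [a * c * (d * b) = (d * b) * (d * b)], the
    passage from [d * b] to [c * a]; the converse goes along [b * d], [d * b],
    [c * a], [a * c]. *)

Section PzRing.
Context {A : pzRingType}.
Implicit Types a b c d e f g p q r s t u v w x y z : A.

Lemma is_unit_lr {x y z} : x * y = 1 -> z * x = 1 -> is_unit x.
Proof.
move=> xy zx; exists y; split=> //.
by rewrite -[y]mul1r -zx -(mulrA z) xy mulr1.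
Qed.

(** Jacobson's lemma: if [w] inverts [1 - x * y], then [1 + y * w * x] inverts
    [1 - y * x]. *)
Lemma is_unit_swap {x y} : is_unit (1 - x * y) -> is_unit (1 - y * x).
Proof.
move=> [w [wr wl]]; exists (1 + y * w * x).
have wr' : x * y * w = w - 1 by rewrite -wr mulrBl mul1r opprB addrC subrK.
have wl' : w * x * y = w - 1
  by rewrite -mulrA -wl mulrBr mulr1 opprB addrC subrK.
split.
  rewrite mulrBl mul1r mulrDr mulr1 !mulrA -(mulrA y x y) -(mulrA y (x * y)) wr'.
  by rewrite mulrBr mulr1 mulrBl addrCA subrr addr0 addrK.
rewrite mulrDl mul1r mulrBr mulr1 !mulrA -(mulrA y w x) -(mulrA y (w * x)) wl'.
by rewrite mulrBr mulr1 mulrBl !mulrA subKr subrK.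
Qed.

(** [1 - x] divides [1 - x ^+ m] on both sides, with the geometric sum as
    cofactor. *)
Lemma is_unit_subX {x} m : is_unit (1 - x ^+ m) -> is_unit (1 - x).
Proof.
pose S := \sum_(i < m) x ^+ i.
have Sl : 1 - x ^+ m = (1 - x) * S by rewrite -opprB subrX1 -mulNr opprB.
have cS : (1 - x) * S = S * (1 - x).
  apply: commr_sym; apply: commrB; first exact: commr1.
  by apply: commr_sym; apply: commr_sum => i _; apply/commrX/commr_refl.
move=> [w []]; rewrite Sl => wr; rewrite cS => wl.
by apply: (@is_unit_lr _ (S * w) (w * S)); rewrite ?mulrA // -mulrA.
Qed.

Lemma comm2_unit {a x w} : comm2 a x -> x * w = 1 -> w * x = 1 -> comm2 a w.
Proof.
move=> cx xw wx y cy.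
by rewrite -[y in LHS]mulr1 -xw (mulrA y) -(cx y cy) !mulrA wx mul1r.
Qed.

Lemma comm2B {a x y} : comm2 a x -> comm2 a y -> comm2 a (x - y).
Proof. by move=> cx cy z cz; rewrite mulrBl mulrBr cx ?cy. Qed.

Lemma comm2D {a x y} : comm2 a x -> comm2 a y -> comm2 a (x + y).
Proof. by move=> cx cy z cz; rewrite mulrDl mulrDr cx ?cy. Qed.

Lemma comm2_1 {a} : comm2 a 1.
Proof. by move=> z _; rewrite mul1r mulr1. Qed.

Lemma comm2M {a x y} : comm2 a x -> comm2 a y -> comm2 a (x * y).
Proof. by move=> cx cy z cz; rewrite -mulrA cy // mulrA cx // mulrA. Qed.

Lemma comm2_comm {a x} : comm2 a x -> x * a = a * x.
Proof. by apply. Qed.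

Lemma comm_1B {a y} : comm (1 - a) y <-> comm a y.
Proof.
rewrite /comm /= mulrBr mulrBl mulr1 mul1r; split=> [|->] //.
by move/addrI/oppr_inj.
Qed.

Lemma comm2_1B {a x} : comm2 (1 - a) x <-> comm2 a x.
Proof. by split=> cx y /comm_1B; apply: cx. Qed.

Lemma qnil_unit1B {t} : qnil t -> is_unit (1 - t).
Proof. by move=> /(_ (-1)); rewrite /comm /= mulrN1 mulN1r; exact. Qed.

(** An inverse [x] gives the spectral idempotent [p = 1 - a * x]. Conversely, if
    [t = p - (1 - a ^+ n)] is quasinilpotent, then [a ^+ n + p = 1 + t] is
    invertible, so [a ^+ n], and with it its factor [a], is invertible on the
    range of [1 - p]. *)
Lemma gnsDrazin_idempotentP {n a} : (0 < n)%N ->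
  has_gnsDrazin n a <->
  exists p, [/\ p * p = p, comm2 a p & qnil (p - (1 - a ^+ n))].
Proof.
case: n => // n _; split.
  move=> [x [xax cx qx]]; have cax : comm2 a (a * x) by apply: comm2M.
  exists (1 - a * x); split.
  - rewrite mulrBl mul1r mulrBr mulr1 -!mulrA (mulrA x) xax.
    by rewrite subrr subr0.
  - by apply: comm2B => //; apply: comm2_1.
  - by rewrite opprB addrC addrA subrK.
move=> [p [pp cp qt]].
have can : comm2 a (a ^+ n) by move=> y cy; apply/commr_sym/commrX.
have canp : comm2 a (a ^+ n.+1 + p).
  by apply: comm2D => //; rewrite exprS; apply: comm2M.
have [w [wr wl]] : is_unit (a ^+ n.+1 + p).
  have := qt 1; rewrite /comm /= mulr1 mul1r.
  by move=> /(_ erefl); rewrite opprB addrCA (addrC p) subrKC.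
have cw : comm2 a w := comm2_unit canp wr wl.
have idq : (1 - p) * (1 - p) = 1 - p.
  by rewrite mulrBl mul1r mulrBr mulr1 pp subrr subr0.
have cy : comm2 a (a ^+ n * w * (1 - p)).
  apply: comm2M; first exact: comm2M.
  by apply: comm2B => //; apply: comm2_1.
have ay : a * (a ^+ n * w * (1 - p)) = 1 - p.
  have -> : a * (a ^+ n * w * (1 - p)) = (1 - p * w) * (1 - p).
    by rewrite -wr mulrDl addrK exprS !mulrA.
  have -> : p * w = w * p by apply: cp; exact: comm2_comm.
  by rewrite mulrBl mul1r -mulrA mulrBr mulr1 pp subrr mulr0 subr0.
exists (a ^+ n * w * (1 - p)); split=> //.
  by rewrite -mulrA ay -mulrA idq.
by rewrite ay opprB addrCA -(opprB 1).
Qed.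

(** For [z] commuting with [e * f], invertibility of [1 + e * f * z] has to come
    from [1 + t * x] with [x] commuting with [t]. Swapping the factors of
    [e * (f * z)] yields no such [x]. It does so for the cube, in which
    [(e * f) ^+ 3 = (e * t) * (t * f)]: the swap produces the product of [t] and
    [f * y * e * t], where [y = (- z) ^+ 3], and these two commute. *)
Lemma qnil_transport e f t : f * e * f = t * f -> f * e * t = t * t ->
  qnil t -> qnil (e * f).
Proof.
move=> fef fet qt z; rewrite /comm /= => cz.
have cNz : GRing.comm (e * f) (- z) by apply/commrN/esym.
have cy : GRing.comm (e * f) ((- z) ^+ 3) by apply: commrX.
rewrite -[_ * z]opprK -mulrN; apply: (is_unit_subX 3).
rewrite exprMn_comm //; move: ((- z) ^+ 3) cy => y cy.
have -> : (e * f) ^+ 3 * y = e * t * (t * f * y).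
  rewrite !exprS expr0 mulr1 !mulrA -!(mulrA e) fef.
  by rewrite !mulrA -!(mulrA (e * t)) fef.
apply: is_unit_swap; rewrite !mulrA.
have := qt (- (f * y * e * t)); rewrite mulrN !mulrA; apply.
rewrite /comm /= mulrN mulNr !mulrA; congr (- _).
rewrite -fef -(mulrA f e) -(mulrA f (e * f)) cy.
by rewrite !mulrA -!(mulrA (f * y * e)) fet.
Qed.

(** With [t = p - m * h] quasinilpotent, [m * h * p = p * (1 - t)], and [1 - t]
    is invertible in the double commutant of [m]: the partial inverse [r] of [m]
    is [h * (1 - t)^-1 * p]. *)
Lemma idempotent_partial_inverse m p h : p * p = p -> comm2 m p ->
  comm2 m h -> qnil (p - m * h) ->
  exists r, [/\ comm2 m r, r * p = r & m * r = p].
Proof.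
move=> pp cp ch; set t := p - m * h => qt.
have [w [wr wl]] := qnil_unit1B qt.
have cmh : comm2 m (m * h) by apply: comm2M.
have cw : comm2 m w.
  apply: comm2_unit wr wl; apply: comm2B; first exact: comm2_1.
  exact: comm2B.
exists (h * w * p); split.
- by apply: comm2M => //; apply: comm2M.
- by rewrite -mulrA pp.
have mhp : m * h * p = p * (1 - t).
  rewrite mulrBr mulr1 mulrBr pp subKr.
  by rewrite -(cp _ (comm2_comm cmh)).
have wp : w * p = p * w by apply: cw; exact: comm2_comm.
by rewrite !mulrA -(mulrA (m * h)) wp mulrA mhp -mulrA wr mulr1.
Qed.

(** An element [z] commuting with [b * d] yields [u = d * z * b * m] commuting
    with [m], hence with [r] and with [v = r ^+ 3]. As
    [r = m * m * v = v * m * m], the element [z] can be turned into [u] on one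
    side of [v], moved across as [u], and turned back into [z]. *)
Lemma comm2_transport b d m r : d * b * d = m * d -> d * b * m = m * m ->
  comm2 m r -> m * r * r = r -> comm2 (b * d) (b * r * d).
Proof.
move=> dbd dbm cr mrr z; rewrite /comm /= => cz.
have [v [cv rE]] : exists v, comm2 m v /\ r = m * m * v.
  exists (r * r * r); split; first by apply: comm2M => //; apply: comm2M.
  by rewrite !mulrA -(mulrA m m) -(mulrA m (m * r)) !mrr.
have rE' : r = v * m * m by rewrite -mulrA cv // /comm /= mulrA.
have [u [cu zbmm ud]] : exists u,
    [/\ comm m u, z * b * m * m = b * u & u * d = m * m * d * z].
  exists (d * z * b * m); split.
  - rewrite /comm /= -mulrA -dbm.
    have -> : d * z * b * (d * b * m) = d * (z * (b * d)) * b * m.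
      by rewrite !mulrA.
    by rewrite cz !mulrA dbd.
  - rewrite -mulrA -dbm.
    have -> : z * b * (d * b * m) = z * (b * d) * b * m by rewrite !mulrA.
    by rewrite cz !mulrA.
  - rewrite -mulrA -dbd.
    have -> : d * z * b * (d * b * d) = d * (z * (b * d) * (b * d)).
      by rewrite !mulrA.
    by rewrite cz -(mulrA (b * d)) cz !mulrA dbd -!(mulrA m) dbd !mulrA.
apply/esym; rewrite {1}rE !mulrA zbmm -(mulrA b) -(cv _ cu) -!mulrA ud.
by rewrite rE' !mulrA.
Qed.

(** If [p] is the idempotent of [1 - m] and [r] the inverse of [m] on its range,
    the idempotent of [1 - b * d] is [b * r * d]. *)
Lemma gnsDrazin_1B_transport n b d m : (0 < n)%N ->
  d * b * d = m * d -> d * b * m = m * m ->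
  has_gnsDrazin n (1 - m) -> has_gnsDrazin n (1 - b * d).
Proof.
move=> n0 dbd dbm /(gnsDrazin_idempotentP n0) [p [pp /comm2_1B cp qt]].
apply/(gnsDrazin_idempotentP n0).
pose G x := \sum_(i < n) (1 - x) ^+ i.
have GE x : 1 - (1 - x) ^+ n = x * G x.
  by rewrite -opprB subrX1 -mulNr opprB subKr.
have cG : comm2 m (G m).
  move=> y cy; apply: commr_sym; apply: commr_sum => i _; apply: commrX.
  by apply: commrB => //; apply: commr1.
have dG : d * G (b * d) = G m * d.
  rewrite mulr_sumr mulr_suml; apply: eq_bigr => i _.
  have dB : d * (1 - b * d) = (1 - m) * d.
    by rewrite mulrBr mulrBl mulr1 mul1r mulrA dbd.
  elim: (i : nat) => [|j IHj]; first by rewrite !expr0 mulr1 mul1r.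
  by rewrite exprS mulrA dB -mulrA IHj mulrA -exprS.
rewrite GE in qt.
have [r [cr rp mr]] := idempotent_partial_inverse m p (G m) pp cp cG qt.
have rm : r * m = p by rewrite -mr; exact: comm2_comm.
have mrr : m * r * r = r by rewrite mr -rm -mulrA mr rp.
have dbr : d * b * r = m * r by rewrite -mrr !mulrA dbm.
exists (b * r * d); split.
- rewrite !mulrA -!(mulrA (b * r)) dbr mr.
  by rewrite mulrA -(mulrA b) rp.
- by apply/comm2_1B; apply: comm2_transport mrr.
have -> : b * r * d - (1 - (1 - b * d) ^+ n) = b * (r - G m) * d.
  by rewrite GE mulrBr mulrBl -!mulrA dG.
(* [p] and [b * r * d] differ from their targets by corresponding elements:
   [p - m * G m = m * (r - G m)] on one side, [b * (r - G m) * d] on the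
   other. *)
apply: (qnil_transport _ _ (p - m * G m)) => //.
  rewrite mulrA mulrBr !mulrBl dbr mr; congr (_ - _).
  by rewrite -(mulrA (d * b)) -dG mulrA dbd -!mulrA dG.
have /comm2_comm : comm2 m (r - G m) by apply: comm2B.
rewrite -mr -mulrBr; move: (r - G m) => g gm.
by rewrite !mulrA -(mulrA _ g m) gm -(mulrA m g m) gm !mulrA dbm.
Qed.

Lemma gnsDrazin_1B_mulC n x y : (0 < n)%N ->
  has_gnsDrazin n (1 - x * y) -> has_gnsDrazin n (1 - y * x).
Proof. by move=> n0; apply: gnsDrazin_1B_transport; rewrite ?mulrA. Qed.

End PzRing.

Theorem theorem3p2 (n : nat) (n_gt0 : (0 < n)%N) (R : realType)
    (A : banachAlgType R[i]) (a b c d : A)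
    (acd_dbd : a * c * d = d * b * d) (dba_aca : d * b * a = a * c * a) :
  has_gnsDrazin n (1 - a * c) <-> has_gnsDrazin n (1 - b * d).
Proof.
split.
  by apply: gnsDrazin_1B_transport => //; rewrite !mulrA dba_aca.
move/(gnsDrazin_1B_mulC _ _ _ n_gt0) => db.
apply: gnsDrazin_1B_mulC => //; apply: gnsDrazin_1B_transport db => //.
by rewrite !mulrA acd_dbd.
Qed.
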